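(* Let $n>2$ and let $(G,f)=\mathrm{der}_{\theta,b}(G,\cdot)$ be an equational noetherian $n$-ary (polyadic) group. Let $H$ be a coordinate polyadic group of some irreducible algebraic set in $(G,f)$. Then there exist a set $I$, an ultrafilter $F$ over $I$ and an element $u=(u_i)/F\in G^I/F$ such that, up to isomorphism, $H$ is a polyadic group with underlying set contained in $G^I/F$ and with operation the restriction of that of the ultrapower $(G,f)^I/F$, and (1) $H$ is an ordinary subgroup of the group $(G^I/F)_u$; (2) for all $(h_i)/F\in H$, we have $(u_i\theta(h_i)\theta(u_i^{-1}))/F\in H$. Conversely, every finitely generated polyadic group $H$ having these properties (for some set $I$, ultrafilter $F$ over $I$ and $u\in G^I/F$) is a coordinate polyadic group of some irreducible algebraic set in $(G,f)$.
   Context: Polyadic groups. Write $x_i^j$ for the sequence $x_i,\ldots,x_j$ and $\stackrel{(t)}{x}$ for $x,\ldots,x$ ($t$ times). An $n$-ary group (polyadic group) is a non-empty set $G$ with an operation $f:G^n\to G$ such that $f(x_1^{i-1},f(x_i^{n+i-1}),x_{n+i}^{2n-1})=f(x_1^{j-1},f(x_j^{n+j-1}),x_{n+j}^{2n-1})$ for all $1\le i<j\le n$ and all $x_1,\ldots,x_{2n-1}\in G$, and such that for all $a_1,\ldots,a_n,c\in G$ and $1\le i\le n$ there is a unique $x\in G$ with $f(a_1^{i-1},x,a_{i+1}^n)=c$. The skew element $\overline{x}$ is the unique $y$ with $f(\stackrel{(n-1)}{x},y)=x$. Polyadic groups form a variety in the language $(f,{}^-)$; finite generation, congruences, and free products are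 taken in this variety. $(G,f)=\mathrm{der}_{\theta,b}(G,\cdot)$ means: $(G,\cdot)$ is a group, $\theta$ an automorphism of it, $b\in G$, $\theta(b)=b$, $\theta^{n-1}(x)=bxb^{-1}$ for all $x\in G$, and $f(x_1,\ldots,x_n)=x_1\theta(x_2)\theta^2(x_3)\cdots\theta^{n-1}(x_n)b$. For an ultrafilter $F$ over a set $I$, the class of $(g_i)_{i\in I}$ in the ultrapower $G^I/F$ is written $(g_i)/F$. The ultrapower $(G,f)^I/F$ equals $\mathrm{der}_{\theta^{\ast},(b)/F}(G^I/F,\cdot)$, where $\theta^{\ast}((g_i)/F)=(\theta(g_i))/F$ and $(b)$ is the constant family. The group $K_u$. For a group $(K,\cdot)$ and $u\in K$, $K_u$ is the group on the set $K$ with operation $x\ast y=xu^{-1}y$ (identity $u$, inverse of $x$ equal to $ux^{-1}u$). Here it is applied to the ultrapower group $K=G^I/F$. Equations. Let $X=\{x_1,\ldots,x_m\}$ be a finite set of variables, and let $G[X]=G\ast F_{pol}^n(X)$ be the free product, in the variety of $n$-ary groups, of $(G,f)$ and the free $n$-ary group $F_{pol}^n(X)$ on $X$. Elements $p=p(x_1,\ldots,x_m)$ of $G[X]$ are called polyadic terms (with coefficients from $G$) and can be evaluated at points of $G^m$. A polyadic equation with coefficients from $G$ is an expression $p\approx q$ with $p,q\in G[X]$; a system is a set $S$ of such equations. The algebraic set of $S$ is $V_G(S)=\{g\in G^m: p(g)=q(g)\text{ for all }(p\approx q)\in S\}$. $(G,f)$ is equational noetherian if for every system $S$ there is a finite subsystem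 $S_0\subseteq S$ with $V_G(S)=V_G(S_0)$. For $Y\subseteq G^m$, $\mathrm{Rad}(Y)$ is the congruence of $G[X]$ consisting of all $(p,q)\in G[X]^2$ with $p(g)=q(g)$ for all $g\in Y$, and $\Gamma(Y)=G[X]/\mathrm{Rad}(Y)$ is the coordinate polyadic group of $Y$. Zariski topology. The closed sets of $G^m$ are the arbitrary intersections of finite unions of algebraic sets. An algebraic set is irreducible if it cannot be covered non-trivially by two closed sets, i.e. it is not the union of two closed proper subsets.
   Formalization: Irreducible sets are taken nonempty (with m≥1), and the copy of H in G^I/F must contain all constants (g)/F, g∈G: this is proved in the direct part and added as a hypothesis in the converse, which is false without it (G=Z^2, H=Z×0, n=3). *)

(* Defs.v *)
From HB Require Import structures.
From mathcomp Require Import all_boot.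
From mathcomp Require Import boolp classical_sets functions cardinality filter.
Set Implicit Arguments.
Unset Strict Implicit.
Unset Printing Implicit Defensive.
Local Open Scope quotient_scope.
Local Open Scope classical_set_scope.
Local Open Scope group_scope.

(* Algebras in the language (f, skew). Points of T^n are functions 'I_n -> T,
   so indices are shifted down by one throughout. *)
Record nalgebra (n : nat) := NAlgebra {
  ncar :> choiceType;
  nop : ('I_n -> ncar) -> ncar;
  nskew : ncar -> ncar
}.

Section NaryGroups.
Variable n : nat.
Implicit Types A B : nalgebra n.

(* f(x_0,...,x_(i-1), f(x_i,...,x_(i+n-1)), x_(i+n),...,x_(2n-2)); only the
   first 2n-1 entries of the sequence x are read. *)
Definition nested_op A (x : nat -> A) (i : 'I_n) : A :=
  nop (fun k : 'I_n =>
    if (k < i)%N then x k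
    else if k == i then nop (fun l : 'I_n => x (i + l)%N)
    else x (k + n.-1)%N).

Definition is_nary_group A : Prop :=
  [/\ inhabited A,
      forall (x : nat -> A) (i j : 'I_n), (i < j)%N ->
        nested_op x i = nested_op x j,
      forall (a : 'I_n -> A) (c : A) (i : 'I_n),
        exists! x : A, nop (fun k => if k == i then x else a k) = c
    & forall x y : A,
        nop (fun k : 'I_n => if k.+1 == n then y else x) = x <-> y = nskew x].

Definition is_nhom A B (h : A -> B) : Prop :=
  (forall x : 'I_n -> A, h (nop x) = nop (h \o x)) /\
  (forall x : A, h (nskew x) = nskew (h x)).

Definition niso A B : Prop :=
  exists h : A -> B, bijective h /\ is_nhom h.

Definition nsubalgebra A (B : set A) : Prop :=
  (forall x : 'I_n -> A, (forall k, B (x k)) -> B (nop x)) /\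
  (forall x : A, B x -> B (nskew x)).

Definition finitely_generated A : Prop :=
  exists2 E : set A, finite_set E &
    forall B : set A, nsubalgebra B -> E `<=` B -> B = setT.

Section Derived.
Variables (G : groupType) (theta : G -> G) (b : G).

Definition der_hyp : Prop :=
  [/\ bijective theta, {morph theta : x y / x * y}, theta b = b
    & forall x, iter n.-1 theta x = b * x * b^-1].

(* The formula for the skew element is justified by der_is_nary_group. *)
Definition der : nalgebra n := @NAlgebra n G
  (fun x => (\prod_(i < n) iter i theta (x i)) * b)
  (fun x => b^-1 * (\prod_(1 <= i < n.-1) iter i theta x)^-1).

End Derived.

End NaryGroups.

Section DerivedTheory.
Variables (n : nat) (G : groupType) (theta : G -> G) (b : G).
Hypothesis derG : der_hyp n.+1 theta b.

Lemma iter_theta1 k : iter k theta 1 = 1.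
Proof.
have [_ thM _ _] := derG; elim: k => //= k ->.
by apply: (mulgI (theta 1)); rewrite -thM !mulg1.
Qed.

Lemma iter_thetaM k : {morph iter k theta : x y / x * y}.
Proof. by have [_ thM _ _] := derG; elim: k => // k IH x y /=; rewrite IH thM. Qed.

Lemma iter_theta_bij k : bijective (iter k theta).
Proof.
by have [thB _ _ _] := derG; elim: k => [|k IH]; [exists id | apply: bij_comp].
Qed.

Lemma iter_theta_b k : iter k theta b = b.
Proof. by have [_ _ thb _] := derG; elim: k => //= k ->. Qed.

Lemma mulb_iter k x : b * iter k theta x = iter (k + n) theta x * b.
Proof.
by have [_ _ _ thn] := derG; rewrite addnC iterD thn mulgVK.
Qed.

Lemma der_nopE (x : nat -> der n.+1 theta b) :
  nop (fun k : 'I_n.+1 => x k) = (\prod_(0 <= k < n.+1) iter k theta (x k)) * b.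
Proof. by rewrite [LHS]/= big_mkord. Qed.

Lemma nested_opE (x : nat -> der n.+1 theta b) (i : 'I_n.+1) :
  nested_op x i = (\prod_(0 <= k < n.+1 + n) iter k theta (x k)) * b * b.
Proof.
pose y k := if (k < i)%N then x k
    else if k == i :> nat then nop (fun l : 'I_n.+1 => x (i + l)%N)
    else x (k + n)%N.
have -> : nested_op x i = nop (fun k : 'I_n.+1 => y k) by [].
rewrite der_nopE; congr (_ * _).
have lin := ltn_ord i.
rewrite (big_cat_nat (n := i)) /= ?(ltnW lin) // (big_ltn lin).
rewrite [in X in _ * (X * _)]/y ltnn eqxx.
rewrite (der_nopE (fun l => x (i + l)%N)) iter_thetaM iter_theta_b.
rewrite (big_morph (iter i theta) (@iter_thetaM i) (iter_theta1 i)).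
rewrite -!mulgA.
have -> : b * \prod_(i.+1 <= k < n.+1) iter k theta (y k) =
    (\prod_(i.+1 <= k < n.+1) iter (k + n) theta (x (k + n)%N)) * b.
  have H : forall s : seq nat, all (fun k => i < k)%N s ->
    b * \prod_(k <- s) iter k theta (y k) =
    (\prod_(k <- s) iter (k + n) theta (x (k + n)%N)) * b.
    elim=> [|k s IH] /=; first by rewrite !big_nil mulg1 mul1g.
    case/andP=> ik sk; rewrite !big_cons mulgA mulb_iter -mulgA IH // mulgA.
    by rewrite /y ltnNge (ltnW ik) /= gtn_eqF.
  by apply: H; apply/allP => k; rewrite mem_index_iota => /andP[].
rewrite !mulgA; congr (_ * _).
rewrite (big_cat_nat (n := i) (p := (n.+1 + n)%N)) //=; last first.
  by rewrite (leq_trans (ltnW lin)) ?leq_addr.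
rewrite -mulgA; congr (_ * _).
  by apply: eq_big_nat => k /andP[_ ki]; rewrite /y ki.
have i2 : (i <= i.+1 + n)%N by rewrite addSnnS leq_addr.
have i3 : (i.+1 + n <= n.+1 + n)%N by rewrite leq_add2r.
rewrite (big_cat_nat i2 i3) /=; congr (_ * _).
  rewrite -[X in \prod_(X <= _ < i.+1 + n) _]add0n big_addn addSnnS addKn.
  by apply: eq_big_nat => k _; rewrite -iterD ![(_ + i)%N]addnC.
by rewrite big_addn addnK.
Qed.

Lemma derS_is_nary_group : (0 < n)%N -> is_nary_group (der n.+1 theta b).
Proof.
move=> n0; split.
- exact: (inhabits b).
- by move=> x i j _; rewrite !nested_opE.
- move=> a c i; pose y x k := if k == i :> nat then x else a (inord k).
  have E x : nop (fun k => if k == i then x else a k) =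
      \prod_(0 <= k < i) iter k theta (a (inord k)) * iter i theta x *
      ((\prod_(i.+1 <= k < n.+1) iter k theta (a (inord k))) * b)
      :> der n.+1 theta b.
    transitivity (nop (fun k : 'I_n.+1 => y x k) : der n.+1 theta b).
      by apply: f_equal; apply/funext => k; rewrite /y inord_val.
    rewrite der_nopE mulgA; congr (_ * _).
    rewrite (big_cat_nat (n := i)) /= ?(ltnW (ltn_ord i)) // (big_ltn (ltn_ord i)).
    rewrite {2}/y eqxx mulgA; congr (_ * _ * _); apply: eq_big_nat => k.
      by move=> /andP[_ ki]; rewrite /y ltn_eqF.
    by move=> /andP[ik _]; rewrite /y gtn_eqF.
  set u := (\prod_(0 <= k < i) _) in E; set v := (_ * b) in E; clearbody u v.
  have [g gK Kg] := iter_theta_bij i.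
  exists (g (u^-1 * c * v^-1)); split; first by rewrite E Kg !mulgA mulgV mul1g mulgVK.
  by move=> x <-; rewrite E !mulgA mulVg mul1g mulgK gK.
- move=> x y.
  have -> : nop (fun k : 'I_n.+1 => if k.+1 == n.+1 then y else x) =
     (\prod_(0 <= k < n) iter k theta x) * (b * y) :> der n.+1 theta b.
    rewrite (der_nopE (fun k => if k.+1 == n.+1 then y else x)).
    rewrite big_nat_recr //= eqxx -mulgA; congr (_ * _); last first.
      by rewrite -[n in LHS]add0n -mulb_iter.
    by apply: eq_big_nat => k /andP[_ kn]; rewrite eqSS ltn_eqF.
  have -> : nskew x = b^-1 * (\prod_(1 <= i < n) iter i theta x)^-1
    :> der n.+1 theta b by [].
  rewrite big_ltn // -mulgA; set p := \prod_(1 <= i < n) _.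
  split=> [|->]; last by rewrite (mulgA b) mulgV mul1g mulgV mulg1.
  rewrite -[RHS]mulg1 => /mulgI; rewrite mulgA => /eqP.
  by rewrite mulg_eq1 => /eqP e; rewrite -invgM e invgK.
Qed.
End DerivedTheory.

Lemma der_is_nary_group (n : nat) (G : groupType) (theta : G -> G) (b : G) :
  (1 < n)%N -> der_hyp n theta b -> is_nary_group (der n theta b).
Proof. by case: n => // n n1 derG; apply: derS_is_nary_group. Qed.

Section FreeProduct.
Variables (n : nat) (A : nalgebra n) (m : nat).

Inductive nterm :=
  | Coef of A
  | Var of 'I_m
  | Op of ('I_n -> nterm)
  | Skew of nterm.

HB.instance Definition _ := gen_eqMixin nterm.
HB.instance Definition _ := gen_choiceMixin nterm.

Fixpoint nterm_val (B : nalgebra n) (c : A -> B) (v : 'I_m -> B) (t : nterm) : B :=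
  match t with
  | Coef a => c a
  | Var j => v j
  | Op s => nop (fun k => nterm_val c v (s k))
  | Skew s => nskew (nterm_val c v s)
  end.

(* Two terms denote the same element of the free product A * F(X) in the
   variety of n-ary groups iff they agree under every interpretation of the
   coefficients (by a homomorphism) and of the variables in an n-ary group. *)
Definition nterm_eq (s t : nterm) : Prop :=
  forall (B : nalgebra n) (c : A -> B) (v : 'I_m -> B),
    is_nary_group B -> is_nhom c -> nterm_val c v s = nterm_val c v t.

Definition nterm_eqb (s t : nterm) : bool := `[< nterm_eq s t >].

Lemma nterm_eqb_equiv : equiv_class_of nterm_eqb.
Proof.
split=> [t|s t|t s u]; first by apply/asboolP.
  by apply/asboolP/asboolP => h B c v gB hc; rewrite h.
by move=> /asboolP h1 /asboolP h2; apply/asboolP => B c v gB hc; rewrite h1 ?h2.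
Qed.

Definition nterm_equiv := EquivRelPack nterm_eqb_equiv.

Definition free_product : nalgebra n := @NAlgebra n {eq_quot nterm_equiv}
  (fun x => \pi_{eq_quot nterm_equiv} (Op (fun k => repr (x k))))
  (fun x => \pi_{eq_quot nterm_equiv} (Skew (repr x))).

Definition fp_coef (a : A) : free_product := \pi_{eq_quot nterm_equiv} (Coef a).
Definition fp_var (j : 'I_m) : free_product := \pi_{eq_quot nterm_equiv} (Var j).

Definition fp_val (B : nalgebra n) (c : A -> B) (v : 'I_m -> B)
  (p : free_product) : B := nterm_val c v (repr p).

Lemma repr_pi_eq (t : nterm) :
  nterm_eq (repr (\pi_{eq_quot nterm_equiv} t)) t.
Proof.
have /eqmodP/asboolP := reprK (\pi_{eq_quot nterm_equiv} t); exact.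
Qed.

Lemma fp_valE (B : nalgebra n) (c : A -> B) (v : 'I_m -> B) (t : nterm) :
  is_nary_group B -> is_nhom c ->
  fp_val c v (\pi_{eq_quot nterm_equiv} t) = nterm_val c v t.
Proof. by move=> gB hc; apply: repr_pi_eq. Qed.

Lemma pi_eq (s t : nterm) : nterm_eq s t ->
  \pi_{eq_quot nterm_equiv} s = \pi_{eq_quot nterm_equiv} t.
Proof. by move=> h; apply/eqmodP/asboolP. Qed.

Lemma fp_coef_hom : is_nhom fp_coef.
Proof.
split=> [x|x]; apply: pi_eq => B c v gB hc /=; case: (hc) => hop hsk.
  rewrite hop; apply: f_equal; apply/funext => k /=.
  by rewrite (repr_pi_eq (Coef (x k)) v gB hc).
by rewrite hsk (repr_pi_eq (Coef x) v gB hc).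
Qed.

Lemma fp_universal (B : nalgebra n) (c : A -> B) (v : 'I_m -> B) :
  is_nary_group B -> is_nhom c ->
  exists! h : free_product -> B,
    [/\ is_nhom h, h \o fp_coef = c & h \o fp_var = v].
Proof.
move=> gB hc; exists (fp_val c v); split.
  split; first by split=> x; rewrite [LHS]fp_valE.
    by apply/funext => a; rewrite [LHS]fp_valE.
  by apply/funext => j; rewrite [LHS]fp_valE.
move=> h [[hop hsk] hcoef hvar]; apply/funext => p.
rewrite -[p]reprK fp_valE //; elim: (repr p) => [a|j|s IH|s IH] /=.
- by rewrite -hcoef.
- by rewrite -hvar.
- transitivity (h (nop (fun k => \pi_{eq_quot nterm_equiv} (s k) : free_product))).
    rewrite hop; apply: f_equal; apply/funext => k; exact: IH.
  apply: f_equal; apply: pi_eq => C d w gC hd /=.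
  by apply: f_equal; apply/funext => k; apply: repr_pi_eq.
- transitivity (h (nskew (\pi_{eq_quot nterm_equiv} s : free_product))).
    by rewrite hsk -IH.
  apply: f_equal; apply: pi_eq => C d w gC hd /=.
  by apply: f_equal; apply: repr_pi_eq.
Qed.

End FreeProduct.

Section AlgebraicGeometry.
Variables (n : nat) (A : nalgebra n) (m : nat).

Definition peval (p : free_product A m) (g : 'I_m -> A) : A := fp_val id g p.

Definition system := set (free_product A m * free_product A m).

Definition alg_set (S : system) : set ('I_m -> A) :=
  [set g | forall pq, S pq -> peval pq.1 g = peval pq.2 g].

Definition is_algebraic (Y : set ('I_m -> A)) : Prop :=
  exists S : system, Y = alg_set S.

Definition zariski_closed (C : set ('I_m -> A)) : Prop :=
  exists2 D : set (set ('I_m -> A)),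
    (forall B, D B -> exists k (S : 'I_k -> system),
       B = \bigcup_i alg_set (S i)) &
    C = \bigcap_(B in D) B.

(* As usual, the empty set is not irreducible: its coordinate n-ary group is
   trivial and need not embed in an ultrapower, since (G,f) may have no
   idempotent. *)
Definition irreducible_algebraic (Y : set ('I_m -> A)) : Prop :=
  [/\ is_algebraic Y, Y !=set0
    & ~ exists C1 C2 : set ('I_m -> A),
        [/\ zariski_closed C1, zariski_closed C2,
            C1 `<` Y, C2 `<` Y & Y = C1 `|` C2]].

Section Coordinate.
Variable Y : set ('I_m -> A).

Definition rad (p q : free_product A m) : bool :=
  `[< forall g, Y g -> peval p g = peval q g >].

Lemma rad_equiv_class : equiv_class_of rad.
Proof.
split=> [p|p q|q p r]; first by apply/asboolP.
  by apply/asboolP/asboolP => h g Yg; rewrite h.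
by move=> /asboolP h1 /asboolP h2; apply/asboolP => g Yg; rewrite h1 ?h2.
Qed.

Definition rad_equiv := EquivRelPack rad_equiv_class.

Definition coordinate : nalgebra n := @NAlgebra n {eq_quot rad_equiv}
  (fun x => \pi_{eq_quot rad_equiv} (nop (fun k => repr (x k))))
  (fun x => \pi_{eq_quot rad_equiv} (nskew (repr x))).

End Coordinate.

End AlgebraicGeometry.

Definition equational_noetherian n (A : nalgebra n) : Prop :=
  forall m, (0 < m)%N -> forall S : system A m,
    exists S0 : system A m,
      [/\ S0 `<=` S, finite_set S0 & alg_set S = alg_set S0].

Definition irreducible_coordinate n (A H : nalgebra n) : Prop :=
  exists m, (0 < m)%N /\
    exists2 Y : set ('I_m -> A), irreducible_algebraic Y & niso H (coordinate Y).

Section Ultrapower.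
Variables (I : Type) (F : set_system I).
Context {UF : UltraFilter F}.

Section Carrier.
Variable T : choiceType.

Definition upow_eq (g h : I -> T) : bool := `[< \forall i \near F, g i = h i >].

Lemma upow_eq_equiv_class : equiv_class_of upow_eq.
Proof.
split=> [g|g h|h g k].
- by apply/asboolP; apply: nearW.
- by apply/asboolP/asboolP; apply: filterS => i ->.
- by move=> /asboolP h1 /asboolP; move: h1 => /[swap] h2 h1; apply/asboolP;
    apply: filterS2 h1 h2 => i -> ->.
Qed.

Definition upow_equiv := EquivRelPack upow_eq_equiv_class.
Definition upow := {eq_quot upow_equiv}.
HB.instance Definition _ := Choice.on upow.

Definition upow_class (g : I -> T) : upow := \pi_{eq_quot upow_equiv} g.

Lemma upow_classP (g h : I -> T) :
  upow_class g = upow_class h <-> \forall i \near F, g i = h i.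
Proof.
by split=> [/eqmodP/asboolP|e]; [exact | apply/eqmodP/asboolP].
Qed.

Lemma repr_upow_class (g : I -> T) : \forall i \near F, repr (upow_class g) i = g i.
Proof. by apply/upow_classP; rewrite /upow_class reprK. Qed.

Lemma upow_reprK (x : upow) : upow_class (repr x) = x.
Proof. exact: reprK. Qed.

End Carrier.

Section GroupStructure.
Variable G : groupType.

Definition upow_one : upow G := upow_class (fun=> 1).
Definition upow_inv (x : upow G) : upow G := upow_class (fun i => (repr x i)^-1).
Definition upow_mul (x y : upow G) : upow G :=
  upow_class (fun i => repr x i * repr y i).

Lemma upow_mulE (g h : I -> G) :
  upow_mul (upow_class g) (upow_class h) = upow_class (fun i => g i * h i).
Proof.
apply/upow_classP.
by apply: filterS2 (repr_upow_class g) (repr_upow_class h) => i -> ->.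
Qed.

Lemma upow_invE (g : I -> G) :
  upow_inv (upow_class g) = upow_class (fun i => (g i)^-1).
Proof. by apply/upow_classP; apply: filterS (repr_upow_class g) => i ->. Qed.

Lemma upow_mulA : associative upow_mul.
Proof.
move=> x y z; rewrite -(upow_reprK x) -(upow_reprK y) -(upow_reprK z).
by rewrite !upow_mulE; congr (upow_class _); apply/funext => i; rewrite mulgA.
Qed.

Lemma upow_mul1 : left_id upow_one upow_mul.
Proof.
move=> x; rewrite -(upow_reprK x) upow_mulE.
by congr (upow_class _); apply/funext => i; rewrite mul1g.
Qed.

Lemma upow_1mul : right_id upow_one upow_mul.
Proof.
move=> x; rewrite -(upow_reprK x) upow_mulE.
by congr (upow_class _); apply/funext => i; rewrite mulg1.
Qed.

Lemma upow_mulV : left_inverse upow_one upow_inv upow_mul.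
Proof.
move=> x; rewrite -(upow_reprK x) upow_invE upow_mulE.
by congr (upow_class _); apply/funext => i; rewrite mulVg.
Qed.

Lemma upow_Vmul : right_inverse upow_one upow_inv upow_mul.
Proof.
move=> x; rewrite -(upow_reprK x) upow_invE upow_mulE.
by congr (upow_class _); apply/funext => i; rewrite mulgV.
Qed.

HB.instance Definition _ := isGroup.Build (upow G)
  upow_mulA upow_mul1 upow_1mul upow_mulV upow_Vmul.

End GroupStructure.

Definition ultrapower n (A : nalgebra n) : nalgebra n := @NAlgebra n (upow A)
  (fun x => upow_class (fun i => nop (fun k => repr (x k) i)))
  (fun x => upow_class (fun i => nskew (repr x i))).

End Ultrapower.

Arguments upow {I} F {UF} T.
Arguments upow_class {I} F {UF T} g.
Arguments ultrapower {I} F {UF n} A.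

(* The group K_u on the set K: x * y := x u^-1 y. *)
Definition translate (K : groupType) (u : K) : Type := K.

Section Translate.
Variables (K : groupType) (u : K).
Local Notation Ku := (translate u).

HB.instance Definition _ := Choice.copy Ku K.

Definition translate_mul (x y : Ku) : Ku :=
  ((x : K) * u^-1 * (y : K))%g.
Definition translate_inv (x : Ku) : Ku := (u * (x : K)^-1 * u)%g.

Lemma translate_mulA : associative translate_mul.
Proof. by move=> x y z; rewrite /translate_mul !mulgA. Qed.

Lemma translate_mul1 : left_id (u : Ku) translate_mul.
Proof. by move=> x; rewrite /translate_mul mulgV mul1g. Qed.

Lemma translate_1mul : right_id (u : Ku) translate_mul.
Proof. by move=> x; rewrite /translate_mul -mulgA mulVg mulg1. Qed.

Lemma translate_mulV : left_inverse (u : Ku) translate_inv translate_mul.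
Proof. by move=> x; rewrite /translate_mul /translate_inv mulgK mulgVK. Qed.

Lemma translate_Vmul : right_inverse (u : Ku) translate_inv translate_mul.
Proof.
by move=> x; rewrite /translate_mul /translate_inv !mulgA mulgVK mulgV mul1g.
Qed.

HB.instance Definition _ := isGroup.Build Ku
  translate_mulA translate_mul1 translate_1mul translate_mulV translate_Vmul.

End Translate.

Section UltrapowerSubgroups.
Variables (n : nat) (G : groupType) (theta : G -> G) (b : G).
Local Notation Gf := (der n theta b).

(* D is the isomorphic copy of H inside the ultrapower. Equations have
   coefficients in G, so H is taken over G: D contains the diagonal copy of G.
   The coordinate n-ary group of a nonempty set always contains a copy of G, so
   this is automatic for them, and without it the converse direction is false:
   for n = 3, theta = id, b = 1 and the additive group Z^2, the subgroup
   Z x 0 (I a point, u = 0) is finitely generated but contains no copy of Z^2. *)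
Definition ultrapower_subgroup (H : nalgebra n) : Prop :=
  is_nary_group H /\
  exists (I : Type) (F : set_system I) (UF : UltraFilter F) (u : I -> G)
         (e : H -> ultrapower F Gf),
    let D : set (upow F G) := range e in
    [/\ injective e /\ is_nhom e,
        forall g : G, D (upow_class F (fun=> g)),
        group_closed [pred x : @translate (upow F G) (upow_class F u) | x \in D]
      & forall h : I -> G, D (upow_class F h) ->
          D (upow_class F (fun i => u i * theta (h i) * theta ((u i)^-1)))].

End UltrapowerSubgroups.

(* Main.v *)
Require Import Defs.
From HB Require Import structures.
From mathcomp Require Import all_boot.
From mathcomp Require Import boolp classical_sets functions cardinality filter.
Set Implicit Arguments.
Unset Strict Implicit.
Unset Printing Implicit Defensive.
Local Open Scope quotient_scope.
Local Open Scope classical_set_scope.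
Local Open Scope group_scope.

(** Both directions come from one correspondence. Say that a family of points,
    indexed by I and taken along an ultrafilter F, is generic for Y when almost
    all its points lie in Y and every equation holding at almost all of them
    holds on all of Y. A nonempty algebraic set is irreducible exactly when it
    has a generic family.

    If Y is irreducible, then for finitely many equations, none of them holding
    identically on Y, some point of Y fails them all: otherwise these equations
    would split Y into two proper closed parts ([irreducible_avoid]). So the sets
    where a given such equation fails have the finite intersection property, and
    an ultrafilter containing them makes the family of all points of Y generic
    ([irreducible_generic_family]). Conversely an ultrafilter is prime, so a
    generic family lies almost everywhere outside every proper closed subset of
    Y, and two such subsets cannot cover Y ([generic_family_irreducible]).

    Direct part. Evaluating terms along a generic family of Y embeds the
    coordinate algebra into the ultrapower, constants going to constants. The
    image D is closed under f and the skew operation and contains the identity of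
    K = G^I/F. As the ultrapower is itself derived, from K with the induced
    automorphism theta, multiplication, theta and inversion of K can be written
    with f, the skew operation and the constants 1, b and b^-1; here n > 2 provides
    the inner argument in which b^-1 cancels the b in the definition of f. So D is
    a theta-stable subgroup of K and u = 1 works
    ([ultrapower_subgroup_embedding]). The same closure properties let one solve
    f(a, .., x, .., a') = c inside D, so that the coordinate algebra is an n-ary
    group ([range_is_nary_group]).

    Converse part. As H contains the constants and is finitely generated, it is a
    quotient of a free product G[X]. Let Y be the algebraic set cut out by all the
    pairs identified in H. Writing the generators of H as elements of the
    ultrapower gives a family of points, and two terms agree in H iff they agree
    at almost all of these points. Noetherianity replaces the equations of Y
    by finitely many, so almost all of the points lie in Y. The family is
    therefore generic for Y, Rad(Y) is the kernel of G[X] -> H, and Y is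
    irreducible ([irreducible_coordinate_of_ultrapower]). *)

(** * Subalgebras of a derived n-ary group that contain the identity *)

Section DerivedSubalgebras.
Variables (n : nat) (K : groupType) (theta : K -> K) (b : K).
Local Notation Kf := (der n.+3 theta b).
Hypothesis derK : der_hyp n.+3 theta b.

Lemma der_theta_inv : {morph theta : x / x^-1}.
Proof.
move=> x; have [_ thM _ _] := derK; apply: (mulgI (theta x)).
by rewrite -thM !mulgV -[LHS]/(iter 1 theta 1) (iter_theta1 derK).
Qed.

(** With all but three arguments equal to 1 the operation becomes, by
    theta^(n+2)(z) = b z b^-1, a word that no longer depends on the arity n+3; the
    group operations are read off from it. *)
Lemma der_nop_sparse (x y z : Kf) :
  nop (fun k : 'I_n.+3 => if k == 0 :> nat then x else if k == 1%N :> nat then y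
    else if k == n.+2 :> nat then z else 1 : Kf) = x * theta y * (b * z) :> K.
Proof.
have [_ _ _ thn] := derK.
rewrite /= big_ord_recl /= big_ord_recl /= big_ord_recr /= eqxx.
rewrite big1 => [|k _]; last first.
  have := ltn_ord k; rewrite /bump /= !add1n.
  case: eqP => [[e]|_ _]; first by rewrite e ltnn.
  exact: (iter_theta1 derK k.+2).
rewrite !mul1g add0n -!mulgA; congr (_ * (_ * _)).
by rewrite -[X in X * b]/(iter n.+2 theta z) thn mulgVK.
Qed.

Variable D : set Kf.
Hypothesis subD : nsubalgebra D.
Hypothesis D1 : D 1.

Let opD := subD.1.
Let skewD := subD.2.

Lemma nsub_b : D b.
Proof.
have := opD (x := fun=> 1) (fun=> D1).
by rewrite /= big1 => [|k _]; rewrite ?mul1g // (iter_theta1 derK).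
Qed.

Lemma nsub_bV : D b^-1.
Proof.
have := skewD D1.
by rewrite /= big1 => [|k _]; rewrite ?invg1 ?mulg1 // (iter_theta1 derK).
Qed.

Lemma nsub_sparse (x y z : K) : D x -> D y -> D z -> D (x * theta y * (b * z)).
Proof.
by move=> Dx Dy Dz; rewrite -der_nop_sparse; apply: opD => k; do 3 case: ifP => // _.
Qed.

(** The choice y := b^-1 as second argument cancels the factor b. *)
Lemma nsub_mul (x y : K) : D x -> D y -> D (x * y).
Proof.
move=> Dx Dy; have [_ thM thb _] := derK.
have := nsub_sparse Dx nsub_bV Dy.
by rewrite der_theta_inv thb mulgA mulgVK.
Qed.

Lemma nsub_theta (x : K) : D x -> D (theta x).
Proof.
by move=> Dx; have := nsub_sparse D1 Dx nsub_bV; rewrite mulgV mulg1 mul1g.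
Qed.

Lemma nsub_iter k (x : K) : D x -> D (iter k theta x).
Proof. by move=> Dx; elim: k => //= k; apply: nsub_theta. Qed.

Lemma nsub_prod (T : Type) (r : seq T) (P : pred T) (x : T -> K) :
  (forall t, P t -> D (x t)) -> D (\prod_(t <- r | P t) x t).
Proof. by move=> Dx; elim/big_ind: _ => //; apply: nsub_mul. Qed.

(** The skew element of x is b^-1 (theta(x) .. theta^(n+1)(x))^-1. Removing all
    factors but the last leaves theta^(n+1)(x)^-1, and one more application of
    theta turns it into the conjugate b x^-1 b^-1. *)
Lemma nsub_inv (x : K) : D x -> D x^-1.
Proof.
move=> Dx; have [_ thM _ thn] := derK.
pose P k := \prod_(1 <= i < k) iter i theta x.
have DPV : D (P n.+2)^-1.
  by have := nsub_mul nsub_b (skewD Dx); rewrite /= mulgA mulgV mul1g.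
have DP : D (P n.+1) by apply: nsub_prod => i _; apply: nsub_iter.
have := nsub_theta (nsub_mul DPV DP).
rewrite /P big_nat_recr //= invgM mulgVK.
set y := iter n.+1 theta x => DyV.
have <- : b^-1 * theta y^-1 * b = x^-1.
  rewrite der_theta_inv; have -> : theta y = b * x * b^-1 by rewrite -thn.
  by rewrite !invgM invgK !mulgA mulVg mul1g mulgVK.
by apply: nsub_mul (nsub_mul nsub_bV DyV) nsub_b.
Qed.

(** The inverse of theta is conjugation by b^-1 followed by theta^(n+1), since
    theta^(n+2) is conjugation by b. *)
Lemma nsub_theta_onto (y : K) : D y -> exists2 x, D x & theta x = y.
Proof.
move=> Dy; have [_ _ _ thn] := derK.
exists (iter n.+1 theta (b^-1 * y * b)).
  by apply/nsub_iter/(nsub_mul (nsub_mul nsub_bV Dy) nsub_b).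
rewrite -[LHS]/(iter n.+2 theta (b^-1 * y * b)) thn.
by rewrite !mulgA mulgV mul1g mulgK.
Qed.

Lemma nsub_iter_onto k (y : K) : D y -> exists2 x, D x & iter k theta x = y.
Proof.
elim: k y => [|k IH] y Dy; first by exists y.
by have [z Dz <-] := nsub_theta_onto Dy; have [x Dx <-] := IH z Dz; exists x.
Qed.

(** Existence of solutions does not pass to a subset; it does here because
    f(.., x, ..) = q1 theta^i(x) q2 b with q1 and q2 in D, so that x is obtained
    from c by operations under which D is closed. *)
Lemma nsub_solve (a : 'I_n.+3 -> Kf) (c : Kf) (i : 'I_n.+3) :
  (forall k, D (a k)) -> D c ->
  exists2 x : Kf, D x & nop (fun k => if k == i then x else a k) = c.
Proof.
move=> Da Dc.
(* Cutting the range of the noncommutative product at i isolates x. *)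
have [s1 [s2 [defs i1 i2]]] : exists s1 s2,
    [/\ index_enum 'I_n.+3 = s1 ++ i :: s2, i \notin s1 & i \notin s2].
  have := index_enum_uniq 'I_n.+3; case/splitPr: (mem_index_enum i) => s1 s2.
  rewrite cat_uniq /= negb_or => /and3P[_ /andP[i1 _] /andP[i2 _]].
  by exists s1, s2.
pose q (s : seq 'I_n.+3) := \prod_(k <- s) iter k theta (a k).
have qE (s : seq 'I_n.+3) x : i \notin s ->
    \prod_(k <- s) iter k theta (if k == i then x else a k) = q s.
  move=> is_; apply: eq_big_seq => k ks.
  by case: eqP => // e; rewrite -e ks in is_.
have Dq s : D (q s) by apply: nsub_prod => k _; apply: nsub_iter.
have [x Dx xE] : exists2 x, D x & iter i theta x = (q s1)^-1 * (c * (q s2 * b)^-1).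
  apply/nsub_iter_onto/nsub_mul; first exact: nsub_inv.
  by apply: nsub_mul => //; apply/nsub_inv/nsub_mul => //; apply: nsub_b.
exists x => //.
rewrite /= defs big_cat big_cons /= eqxx !qE // xE.
by rewrite -!mulgA mulgA mulgV mul1g mulVg mulg1.
Qed.

(** Associativity, uniqueness of solutions and the law of the skew element are
    reflected by the embedding e; only existence of solutions needs
    [nsub_solve]. *)
Lemma range_is_nary_group (H : nalgebra n.+3) (e : H -> Kf) :
  injective e -> is_nhom e -> range e = D -> is_nary_group H.
Proof.
move=> ei [eop eskew] eD.
have eDP y : D y -> exists x, e x = y by rewrite -eD => -[x _ <-]; exists x.
have De x : D (e x) by rewrite -eD; exists x.
have enop (a : 'I_n.+3 -> H) x i : e (nop (fun k => if k == i then x else a k)) =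
    nop (fun k => if k == i then e x else e (a k)).
  by rewrite eop; apply: f_equal; apply/funext => k /=; case: eqP.
have [_ Kassoc Ksol Kskew] : is_nary_group Kf by apply: der_is_nary_group.
split.
- by have [x _] := eDP _ D1; exists.
- have enest (x : nat -> H) i : e (nested_op x i) = nested_op (e \o x) i.
    rewrite /nested_op eop; apply: f_equal; apply/funext => k /=.
    case: ifP => // _; case: ifP => // _; rewrite eop.
  by move=> x i j ij; apply: ei; rewrite !enest; apply: Kassoc.
- move=> a c i; have [y Dy yE] := nsub_solve i (fun k => De (a k)) (De c).
  have [x exy] := eDP y Dy.
  exists x; split=> [|x' x'E]; first by apply: ei; rewrite enop exy.
  apply: ei; have [z [_ zu]] := Ksol (fun k => e (a k)) (e c) i.
  by rewrite exy -(zu _ yE) -(zu (e x')) // -enop x'E.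
- move=> x y; split=> [E|->].
    apply: ei; rewrite eskew; apply/Kskew; rewrite -[RHS](congr1 e E) eop.
    by apply: f_equal; apply/funext => k /=; case: ifP.
  apply: ei; rewrite -[RHS](iffRL (Kskew (e x) (e (nskew x)))) ?eskew // eop.
  by apply: f_equal; apply/funext => k /=; case: ifP; rewrite ?eskew.
Qed.

End DerivedSubalgebras.

(** * The ultrapower of a derived n-ary group is derived *)

Section UltrapowerOperations.
Variables (I : Type) (F : set_system I).
Context {UF : UltraFilter F}.

Lemma ultrapower_nopE n (A : nalgebra n) (x : 'I_n -> I -> A) :
  nop (fun k => upow_class F (x k) : ultrapower F A) =
  upow_class F (fun i => nop (fun k => x k i)).
Proof.
apply/upow_classP.
have : \forall i \near F, forall k, repr (upow_class F (x k)) i = x k i.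
  by apply: filter_forall => k; apply: repr_upow_class.
by apply: filterS => i E; apply: f_equal; apply/funext.
Qed.

Lemma ultrapower_nskewE n (A : nalgebra n) (x : I -> A) :
  nskew (upow_class F x : ultrapower F A) = upow_class F (fun i => nskew (x i)).
Proof. by apply/upow_classP; apply: filterS (repr_upow_class x) => i ->. Qed.

Section UltrapowerOfDerived.
Variables (n : nat) (G : groupType) (theta : G -> G) (b : G).

Definition upow_theta (x : upow F G) : upow F G :=
  upow_class F (fun i => theta (repr x i)).

Let mulE (g h : I -> G) : (upow_class F g : upow F G) * upow_class F h =
  upow_class F (fun i => g i * h i).
Proof. exact: upow_mulE. Qed.

Let invE (g : I -> G) : (upow_class F g : upow F G)^-1 =
  upow_class F (fun i => (g i)^-1).
Proof. exact: upow_invE. Qed.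

Lemma upow_thetaE (g : I -> G) :
  upow_theta (upow_class F g) = upow_class F (theta \o g).
Proof.
by apply/upow_classP; apply: filterS (repr_upow_class g) => i /= ->.
Qed.

Lemma iter_upow_theta k (g : I -> G) :
  iter k upow_theta (upow_class F g) = upow_class F (iter k theta \o g).
Proof. by elim: k => //= k ->; rewrite upow_thetaE. Qed.

Lemma upow_prodE (T : Type) (r : seq T) (g : T -> I -> G) :
  \prod_(t <- r) upow_class F (g t) =
  upow_class F (fun i => \prod_(t <- r) g t i) :> upow F G.
Proof.
elim: r => [|t r IH].
  by rewrite big_nil; apply/upow_classP; apply: nearW => i; rewrite big_nil.
rewrite big_cons IH mulE; apply/upow_classP.
by apply: nearW => i; rewrite big_cons.
Qed.

Lemma upow_der_hyp : der_hyp n theta b ->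
  der_hyp n upow_theta (upow_class F (fun=> b)).
Proof.
case=> -[th' thK thK'] thM thb thn; split.
- exists (fun x : upow F G => upow_class F (fun i => th' (repr x i))) => x;
    rewrite -[x in RHS]upow_reprK; apply/upow_classP.
    apply: filterS (repr_upow_class (fun i => theta (repr x i))) => i ->.
    by rewrite thK.
  apply: filterS (repr_upow_class (fun i => th' (repr x i))) => i ->.
  by rewrite thK'.
- move=> x y; rewrite -(upow_reprK x) -(upow_reprK y).
  rewrite mulE !upow_thetaE mulE.
  by apply/upow_classP; apply: nearW => i /=; rewrite thM.
- by rewrite upow_thetaE; apply/upow_classP; apply: nearW => i /=.
- move=> x; rewrite -(upow_reprK x) iter_upow_theta.
  rewrite invE (mulE (fun=> b) (repr x)) mulE.
  by apply/upow_classP; apply: nearW => i; apply: thn.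
Qed.

Lemma ultrapower_nop_der (x : 'I_n -> upow F G) :
  nop (x : 'I_n -> ultrapower F (der n theta b)) =
  nop (x : 'I_n -> der n upow_theta (upow_class F (fun=> b))).
Proof.
have -> : x = (fun k => upow_class F (repr (x k))).
  by apply/funext => k; rewrite upow_reprK.
rewrite (@ultrapower_nopE n (der n theta b)) /=.
under eq_bigr do rewrite iter_upow_theta.
by rewrite upow_prodE mulE.
Qed.

Lemma ultrapower_nskew_der (x : upow F G) :
  nskew (x : ultrapower F (der n theta b)) =
  nskew (x : der n upow_theta (upow_class F (fun=> b))).
Proof.
rewrite -(upow_reprK x) (@ultrapower_nskewE n (der n theta b)) /=.
under eq_bigr do rewrite iter_upow_theta.
by rewrite upow_prodE !invE mulE.
Qed.

End UltrapowerOfDerived.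

End UltrapowerOperations.

(** * Generic families of points *)

Lemma fp_val_hom n (A B : nalgebra n) m (c : A -> B) (v : 'I_m -> B) :
  is_nary_group B -> is_nhom c -> is_nhom (fp_val c v).
Proof. by move=> gB hc; split=> x; rewrite [LHS]fp_valE. Qed.

Section GenericFamilies.
Variables (n : nat) (A : nalgebra n) (m : nat).
Local Notation eqn := (free_product A m * free_product A m)%type.

(** The family [pt] represents a point of Y over the ultrapower along F; the
    second condition says that this point satisfies no equations but those of Y,
    as a generic point does in algebraic geometry. *)
Definition generic_family (Y : set ('I_m -> A)) (I : Type) (F : set_system I)
    (pt : I -> 'I_m -> A) : Prop :=
  (\forall i \near F, Y (pt i)) /\
  forall p q : free_product A m,
    (\forall i \near F, peval p (pt i) = peval q (pt i)) -> rad Y p q.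

(** A proper closed subset is contained in a finite union of solution sets of
    single equations, none of which holds on Y. An ultrafilter makes each of
    them fail almost everywhere, and then all of them at once. *)
Lemma generic_escapes_closed (Y C : set ('I_m -> A)) (I : Type)
    (F : set_system I) {UF : UltraFilter F} (pt : I -> 'I_m -> A) :
  generic_family Y F pt -> zariski_closed C -> C `<` Y ->
  \forall i \near F, ~ C (pt i).
Proof.
move=> [_ gen] [D DU ->] [_ nYC].
have [B [DB nYB]] : exists B, D B /\ ~ Y `<=` B.
  apply: contra_notP nYC => nB g Yg B DB.
  by apply: contrapT => nBg; apply: nB; exists B; split=> // /(_ g Yg).
have [k [S BE]] := DU B DB; rewrite BE in nYB.
have : \forall i \near F, forall j, ~ alg_set (S j) (pt i).
  apply: filter_forall => j.
  have [pq Spq nrad] : exists2 pq, S j pq & ~ rad Y pq.1 pq.2.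
    apply: contra_notP nYB => nS g Yg; exists j => // pq Spq.
    apply: contrapT => npq; apply: nS; exists pq => // rpq.
    by apply: npq; move/asboolP: rpq; apply.
  have [/(gen pq.1 pq.2) //|] := in_ultra_setVsetC
    [set i | peval pq.1 (pt i) = peval pq.2 (pt i)] UF.
  by move=> Fn; apply: filterS Fn => i npq /(_ pq Spq).
by apply: filterS => i nS /(_ B DB); rewrite BE => -[j _ /(nS j)].
Qed.

Lemma generic_family_irreducible (Y : set ('I_m -> A)) (I : Type)
    (F : set_system I) {UF : UltraFilter F} (pt : I -> 'I_m -> A) :
  is_algebraic Y -> generic_family Y F pt -> irreducible_algebraic Y.
Proof.
move=> algY gen; have [inY _] := gen; split=> //.
  by have [i Yi] := filter_ex inY; exists (pt i).
move=> [C1 [C2 [cl1 cl2 C1Y C2Y YE]]].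
have n1 : \forall i \near F, ~ C1 (pt i).
  exact: generic_escapes_closed gen cl1 C1Y.
have n2 : \forall i \near F, ~ C2 (pt i).
  exact: generic_escapes_closed gen cl2 C2Y.
have [i [Yi [n1i n2i]]] := filter_ex (filterI inY (filterI n1 n2)).
by rewrite YE in Yi; case: Yi.
Qed.

Lemma zariski_closed_equations (Y : set ('I_m -> A)) (s : seq eqn) :
  is_algebraic Y ->
  zariski_closed [set g | Y g /\ exists2 pq, pq \in s & peval pq.1 g = peval pq.2 g].
Proof.
move=> [S ->].
exists [set \bigcup_(j : 'I_(size s)) alg_set (S `|` [set tnth (in_tuple s) j])].
  by move=> _ ->; exists (size s), (fun j => S `|` [set tnth (in_tuple s) j]).
rewrite bigcap_set1; apply/seteqP; split=> g.
  move=> [Sg [pq pqs E]]; have ls : (index pq s < size s)%N by rewrite index_mem.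
  exists (Ordinal ls) => // rt [/Sg //|->].
  by rewrite (tnth_nth pq) /= nth_index.
move=> [j _ Sg]; split=> [pq Spq|]; first by apply: Sg; left.
by exists (tnth (in_tuple s) j); [exact: mem_tnth | apply: Sg; right].
Qed.

(** If each point of Y satisfied the first equation or one of the others, then Y
    would be covered by two closed sets, the first proper because the first
    equation fails somewhere on Y, the second by induction. *)
Lemma irreducible_avoid (Y : set ('I_m -> A)) (s : seq eqn) :
  irreducible_algebraic Y -> (forall pq, pq \in s -> ~ rad Y pq.1 pq.2) ->
  exists2 g, Y g & forall pq, pq \in s -> peval pq.1 g <> peval pq.2 g.
Proof.
move=> [algY [g0 Yg0] irr]; elim: s => [|pq s IH] nrad; first by exists g0.
have [rt rts|g Yg gs] := IH; first by apply: nrad; rewrite inE rts orbT.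
apply: contrapT => no; apply: irr.
pose C (t : seq eqn) :=
  [set g | Y g /\ exists2 pq, pq \in t & peval pq.1 g = peval pq.2 g].
exists (C [:: pq]), (C s); split; try exact: zariski_closed_equations.
- split; first by move=> ? [].
  move=> YC; apply: (nrad pq); first by rewrite inE eqxx.
  by apply/asboolP => h /YC[_ [rt]]; rewrite inE => /eqP ->.
- split; first by move=> ? [].
  by move=> /(_ g Yg)[_ [rt /gs]].
- apply/seteqP; split=> [h Yh|h [[]|[]] //].
  apply: contrapT => nC; apply: no; exists h => // rt.
  rewrite inE => /predU1P[->|rts] E; apply: nC; [left|right]; split=> //.
    by exists pq; rewrite ?inE.
  by exists rt.
Qed.

(** The index set is Y itself, and the ultrafilter contains, for each equation
    that fails somewhere on Y, the set of points where it fails. *)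
Lemma irreducible_generic_family (Y : set ('I_m -> A)) :
  irreducible_algebraic Y ->
  exists (I : Type) (F : set_system I) (UF : UltraFilter F)
    (pt : I -> 'I_m -> A), (forall i, Y (pt i)) /\ generic_family Y F pt.
Proof.
move=> irr; pose I := {g | Y g}; pose pt (i : I) := sval i.
pose N := [set pq : eqn | ~ rad Y pq.1 pq.2].
pose f (pq : eqn) :=
  [set i : I | peval pq.1 (pt i) <> peval pq.2 (pt i)].
have /finI_filter PF : finI N f.
  move=> s sN; have [pq pqs|g Yg gs] := @irreducible_avoid Y (finmap.enum_fset s) irr.
    by have := sN _ pqs; rewrite inE.
  by exists (exist _ g Yg) => pq pqs; apply: gs.
have [F [UF FE]] := ultraFilterLemma PF.
exists I, F, UF, pt; split=> [[]//|]; split; first by apply: nearW => -[].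
move=> p q near_pq; apply: contrapT => npq.
have Ff : F (f (p, q)) by apply: FE; exists (f (p, q)) => //; apply: finI_from1.
by have [i []] := filter_ex (filterI near_pq Ff).
Qed.

Lemma repr_piP (Y : set ('I_m -> A)) (p : free_product A m) :
  rad Y (repr (\pi_{eq_quot (rad_equiv Y)} p)) p.
Proof. by have /eqmodP := reprK (\pi_{eq_quot (rad_equiv Y)} p). Qed.

Section CoordinateEmbedding.
Hypothesis grpA : is_nary_group A.
Variables (Y : set ('I_m -> A)) (I : Type) (F : set_system I).
Context {UF : UltraFilter F}.
Variable pt : I -> 'I_m -> A.
Hypothesis ptY : forall i, Y (pt i).
Hypothesis gen : generic_family Y F pt.

Definition coordinate_val (p : coordinate Y) : ultrapower F A :=
  upow_class F (fun i => peval (repr p) (pt i)).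

Lemma coordinate_val_pi (p : free_product A m) :
  coordinate_val (\pi_{eq_quot (rad_equiv Y)} p) =
  upow_class F (fun i => peval p (pt i)).
Proof.
by apply/upow_classP; apply: nearW => i;
  have /asboolP/(_ (pt i) (ptY i)) := repr_piP Y p.
Qed.

Lemma coordinate_val_inj : injective coordinate_val.
Proof.
move=> p q /upow_classP/gen.2 pq.
by rewrite -[p]reprK -[q]reprK; apply/eqmodP.
Qed.

Lemma coordinate_val_hom : is_nhom coordinate_val.
Proof.
have valh i : is_nhom ((@peval n A m)^~ (pt i)) by apply: fp_val_hom.
split=> x.
  rewrite [LHS]coordinate_val_pi ultrapower_nopE.
  by apply/upow_classP; apply: nearW => i; apply: (valh i).1.
rewrite [LHS]coordinate_val_pi ultrapower_nskewE.
by apply/upow_classP; apply: nearW => i; apply: (valh i).2.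
Qed.

Lemma coordinate_val_coef (a : A) :
  coordinate_val (\pi_{eq_quot (rad_equiv Y)} (fp_coef m a)) =
  upow_class F (fun=> a).
Proof.
rewrite coordinate_val_pi; apply/upow_classP; apply: nearW => i.
by rewrite [LHS]fp_valE.
Qed.

End CoordinateEmbedding.

End GenericFamilies.

(** * Coordinate n-ary groups inside ultrapowers *)

Lemma range_nsubalgebra n (B H : nalgebra n) (phi : B -> H) :
  is_nhom phi -> nsubalgebra (range phi).
Proof.
move=> [pop psk]; split=> [x xD|_ [x _ <-]]; last first.
  by rewrite -psk; exists (nskew x).
have preim k : exists y, phi y = x k by have [y _ yE] := xD k; exists y.
have [y yE] := choice preim.
by exists (nop y) => //; rewrite pop; apply: f_equal; apply/funext => k /=.
Qed.

(** The image contains the identity of the ultrapower group, so u = 1 can be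
    chosen: the group K_u is then K itself, and condition (2) is stability under
    theta. *)
Lemma ultrapower_subgroup_embedding (n : nat) (G : groupType) (theta : G -> G)
    (b : G) (H : nalgebra n) (I : Type) (F : set_system I) (UF : UltraFilter F)
    (e : H -> ultrapower F (der n theta b)) :
  (2 < n)%N -> der_hyp n theta b -> injective e -> is_nhom e ->
  (forall g : G, range e (upow_class F (fun=> g))) -> ultrapower_subgroup theta b H.
Proof.
case: n H e => [|[|[|n]]] // H e _ derG ei eh eG.
pose Kf := der n.+3 (@upow_theta I F UF G theta) (upow_class F (fun=> b)).
have derF := @upow_der_hyp I F UF n.+3 G theta b derG.
have eh' : is_nhom (e : H -> Kf).
  split=> x; first by rewrite -ultrapower_nop_der -eh.1.
  by rewrite -ultrapower_nskew_der -eh.2.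
have subD : nsubalgebra (range e : set Kf) by apply: range_nsubalgebra.
have D1 : (range e : set Kf) 1 by apply: eG.
split; first exact: (range_is_nary_group derF subD D1 ei eh').
exists I, F, UF, (fun=> 1), e; split=> //.
- split; first by rewrite inE; apply: eG.
  move=> x y; rewrite !inE => Dx Dy.
  (* The left-hand product and inverse are those of K_u for u = 1. *)
  suff -> : x * y^-1 = (x : upow F G) * (y : upow F G)^-1 :> upow F G.
    exact: (nsub_mul derF subD D1 Dx (nsub_inv derF subD D1 Dy)).
  rewrite -[LHS]/((x : upow F G) * 1^-1 * (1 * (y : upow F G)^-1 * 1)).
  by rewrite invg1 !mulg1 mul1g.
- move=> x Dx; have := nsub_theta derF subD D1 Dx; rewrite upow_thetaE.
  congr (range e _); apply/upow_classP; apply: nearW => i /=.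
  by rewrite mul1g invg1 -[theta 1]/(iter 1 theta 1) (iter_theta1 derG) mulg1.
Qed.

Lemma ultrapower_subgroup_irreducible (n : nat) (G : groupType) (theta : G -> G)
    (b : G) (H : nalgebra n) :
  (2 < n)%N -> der_hyp n theta b ->
  irreducible_coordinate (der n theta b) H -> ultrapower_subgroup theta b H.
Proof.
move=> n2 derG [m [_ [Y irrY [h [[h' hK h'K] [hop hsk]]]]]].
have grpG := der_is_nary_group (ltnW n2) derG.
have [I [F [UF [pt [ptY gen]]]]] := irreducible_generic_family irrY.
have [vop vsk] := @coordinate_val_hom _ _ _ grpG Y I F UF pt ptY.
apply: (@ultrapower_subgroup_embedding _ _ _ _ _ I F UF
  (@coordinate_val _ _ _ Y I F UF pt \o h)) => //.
- by apply: inj_comp (can_inj hK); apply: coordinate_val_inj.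
- by split=> x /=; rewrite ?hop ?hsk ?vop ?vsk.
- move=> g; exists (h' (\pi_{eq_quot (rad_equiv Y)} (fp_coef m (g : der n theta b)))) => //.
  rewrite /comp h'K.
  by apply: (coordinate_val_coef grpG ptY (g : der n theta b)).
Qed.

(** * Finitely generated subalgebras of ultrapowers *)

Section FinitelyGenerated.
Variables (n : nat) (A H : nalgebra n).
Hypotheses (grpA : is_nary_group A) (grpH : is_nary_group H).

Lemma finitely_generated_fp_onto (c : A -> H) : is_nhom c ->
  finitely_generated H ->
  exists2 m, (0 < m)%N & exists v : 'I_m -> H, range (fp_val c v) = setT.
Proof.
move=> hc [E /finite_seqP[s ->] gen]; have [[x0] _ _ _] := grpH.
(* The extra variable, sent to the default value x0, makes m positive. *)
exists (size s).+1 => //; exists (fun j => nth x0 s j).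
apply: gen; first by apply/range_nsubalgebra/fp_val_hom.
move=> y /= ys; have ls : (index y s < (size s).+1)%N by rewrite ltnS index_size.
exists (fp_var A (Ordinal ls)) => //.
by rewrite [LHS]fp_valE //= nth_index.
Qed.

(** The part of the theorem of Los that is needed: evaluating a term in the
    ultrapower is evaluating it coordinatewise. *)
Lemma ultrapower_fp_val (I : Type) (F : set_system I) {UF : UltraFilter F}
    (e : H -> ultrapower F A) (m : nat) (c : A -> H) (v : 'I_m -> H)
    (pt : I -> 'I_m -> A) (p : free_product A m) :
  is_nhom e -> (forall a, e (c a) = upow_class F (fun=> a)) ->
  (forall j, e (v j) = upow_class F (fun i => pt i j)) ->
  e (fp_val c v p) = upow_class F (fun i => peval p (pt i)).
Proof.
move=> [eop esk] ec ev; rewrite /peval /fp_val.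
elim: (repr p) => [a|j|s IH|s IH] //=.
  rewrite eop -ultrapower_nopE; apply: f_equal; apply/funext => k /=; exact: IH.
by rewrite esk IH ultrapower_nskewE.
Qed.

Lemma niso_coordinate m (phi : free_product A m -> H) (Y : set ('I_m -> A)) :
  is_nhom phi -> range phi = setT ->
  (forall p q, rad Y p q <-> phi p = phi q) -> niso H (coordinate Y).
Proof.
move=> [pop psk] onto radE.
have preim x : exists p, phi p = x.
  have [p _ px] : range phi x by rewrite onto.
  by exists p.
have [psi psiK] := choice preim.
have reprE p : phi (repr (\pi_{eq_quot (rad_equiv Y)} p)) = phi p.
  by apply/radE/repr_piP.
exists (fun x => \pi_{eq_quot (rad_equiv Y)} (psi x)); split.
  exists (fun p => phi (repr p)) => [x|p]; first by rewrite reprE psiK.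
  by rewrite -[RHS]reprK; apply/eqmodP/radE; rewrite psiK.
split=> x; apply/eqmodP/radE; rewrite psiK ?pop ?psk ?reprE ?psiK //.
by apply: f_equal; apply/funext => k /=; rewrite reprE psiK.
Qed.

(** Each equation of Y holds at almost all points of the family, but a filter
    need not be closed under infinite intersections: that almost all points
    satisfy all the equations at once, as [inY] asserts, is where a finite
    subsystem is needed. *)
Lemma irreducible_coordinate_of_ultrapower (I : Type) (F : set_system I)
    {UF : UltraFilter F} (e : H -> ultrapower F A) :
  equational_noetherian A -> finitely_generated H ->
  injective e -> is_nhom e -> (forall a : A, range e (upow_class F (fun=> a))) ->
  irreducible_coordinate A H.
Proof.
move=> noethA fgH ei eh eA; have [eop esk] := eh.
have preim a : exists x, e x = upow_class F (fun=> a).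
  by have [x _ xE] := eA a; exists x.
have [c ec] := choice preim.
have hc : is_nhom c.
  split=> x; apply: ei; rewrite ?eop ?esk !ec.
    rewrite -ultrapower_nopE; apply: f_equal; apply/funext => k /=.
    by rewrite ec.
  by rewrite ultrapower_nskewE.
have [m m0 [v onto]] := finitely_generated_fp_onto hc fgH.
set phi := fp_val c v in onto.
pose pt i j := repr (e (v j)) i.
have evE p : e (phi p) = upow_class F (fun i => peval p (pt i)).
  by apply: ultrapower_fp_val => // j; rewrite upow_reprK.
have phiE p q : phi p = phi q <->
    \forall i \near F, peval p (pt i) = peval q (pt i).
  split=> [E|/upow_classP E]; last by apply: ei; rewrite !evE.
  by apply/upow_classP; rewrite -!evE E.
pose Y := alg_set [set pq | phi pq.1 = phi pq.2].
have inY : \forall i \near F, Y (pt i).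
  have [S0 [S0S /finite_fsetP[X S0X] YE]] := noethA m m0 [set pq | phi pq.1 = phi pq.2].
  rewrite /Y YE {YE}; rewrite S0X in S0S *.
  have := @filter_bigI _ _ X
    (fun pq => [set i | peval pq.1 (pt i) = peval pq.2 (pt i)]) F _.
  by apply=> pq pqX; apply/phiE; apply: S0S.
have radE p q : rad Y p q <-> phi p = phi q.
  split=> [/asboolP E|E]; last by apply/asboolP => g /(_ (p, q)); apply.
  by apply/phiE; apply: filterS inY => i /E.
exists m; split=> //; exists Y; last exact: niso_coordinate (fp_val_hom _ _ _) onto radE.
apply: (@generic_family_irreducible _ _ _ _ I F UF pt); first by eexists.
by split=> // p q /phiE/radE.
Qed.

End FinitelyGenerated.

Theorem theorem5p4 (n : nat) (n_gt2 : (2 < n)%N) (G : groupType)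
    (theta : G -> G) (b : G) (derG : der_hyp n theta b)
    (noethG : equational_noetherian (der n theta b)) :
  (forall H : nalgebra n,
     irreducible_coordinate (der n theta b) H ->
     ultrapower_subgroup theta b H) /\
  (forall H : nalgebra n,
     finitely_generated H -> ultrapower_subgroup theta b H ->
     irreducible_coordinate (der n theta b) H).
Proof.
split=> H; first exact: ultrapower_subgroup_irreducible.
move=> fgH [grpH [I [F [UF [u [e [[ei eh] eG _ _]]]]]]].
have grpG := der_is_nary_group (ltnW n_gt2) derG.
exact: (irreducible_coordinate_of_ultrapower grpH noethG fgH ei eh eG).
Qed.
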